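(* Let $\varepsilon>0$. For Lebesgue almost every $\alpha\in[0,1]$ the following holds: for every $\delta>0$ there exists $N_0=N_0(\alpha,\varepsilon,\delta)$ such that for all integers $N\geqslant N_0$ and all real $L$ with $N^{1/4+\varepsilon}<L\leqslant N$ we have \[ \big|\mathbb{E}\, W_{\alpha,L,N}^3 - L^3\big|\leqslant \delta L^3 .\] (That is, $\mathbb{E} W_{\alpha,L,N}^3=L^3(1+o_{\alpha,\varepsilon}(1))$ as $N\to\infty$, with the $o(1)$ term independent of the choice of $L$ in the range.)
   Context: Let $Y$ be a random variable uniformly distributed on $[0,1)$. For $\alpha\in[0,1]$, $N\in\mathbb{N}$ and real $0<L\leqslant N$, define the random variable \[ W_{\alpha,L,N}:=\big|\{n\in\{1,\dots,N\}:\ \alpha n^2\in[Y,Y+L/N] \ (\mathrm{mod}\ 1)\}\big|, \] and $\mathbb{E}$ denotes expectation over $Y$. *)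

(* Defs.v *)
From HB Require Import structures.
From mathcomp Require Export all_boot all_order all_algebra.
From mathcomp Require Export all_classical all_reals all_analysis.

Set Implicit Arguments.
Unset Strict Implicit.
Unset Printing Implicit Defensive.

Import Order.TTheory GRing.Theory Num.Theory.
Import numFieldNormedType.Exports.

Local Open Scope classical_set_scope.
Local Open Scope ring_scope.

(* The law of Y is Lebesgue measure restricted to [0, 1).  The library's
   [uniform_prob] is defined on the closed interval instead. *)
Definition uniform01 (R : realType) (d : measure_display)
    (T : measurableType d) (P : probability T R) (Y : {RV P >-> R}) : Prop :=
  forall A : set R, measurable A ->
    distribution P Y A = lebesgue_measure (A `&` `[0, 1[%classic).

(* x lies in the real interval [a, b] modulo 1, i.e. some integer translate of
   x lies in [a, b]. *)
Definition in_itv_mod1 (R : realType) (x a b : R) : Prop :=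
  exists k : int, a <= x + k%:~R <= b.

(* W_{alpha,L,N} at the value y of Y; the index i < N stands for n = i + 1. *)
Definition Wcount (R : realType) (alpha L : R) (N : nat) (y : R) : nat :=
  #|[set i : 'I_N |
      `[< in_itv_mod1 (alpha * i.+1%:R ^+ 2) y (y + L / N%:R) >]]%SET|.

(* Main.v *)
From HB Require Import structures.
Require Import Defs.
From mathcomp Require Import lra ring zify measurable_realfun.
Import Order.TTheory GRing.Theory Num.Theory.
Import numFieldNormedType.Exports.
Local Open Scope classical_set_scope.
Local Open Scope ring_scope.

Set Implicit Arguments.
Unset Strict Implicit.
Unset Printing Implicit Defensive.

(** Write V_h(y) for the number of n <= N with alpha n^2 in [y, y+h) mod 1,
    minus N h.  For (alpha, y) uniform on the torus the points y - alpha n^2 are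
    pairwise independent, so the mean of V_h^2 over alpha and y is at most
    2 N h.  Take N = j^A with A = 4 B large and the O(j) lengths h = (l/j)^A and
    h = j^-i; summing the second moments with weights shows that, for almost
    every alpha, the y-mean of V_h^2 is O(j^3 N h) for all of these at once.

    Chaining along the base-j grids y_0 + j^-i Z (i <= A), averaged over the
    origin y_0, turns these mean square bounds into a uniform discrepancy bound
    |V_h(y)| <= D with D = O(j^(2B+3)), about N^(1/2).  As V_h has mean 0, the
    third moment of V_h + N h differs from (N h)^3 by at most
    (3 N h + D) E V_h^2, which is o((N h)^3) when N h > N^(1/4+eps).

    The number W is monotone in N and in h, and consecutive terms of j^A and of
    l^A have ratio tending to 1, so general N and L follow by sandwiching. *)

(** * Bounded measurable functions and their means *)

(** This class is closed under the operations used below and integrable for every probability, so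
    integrability is never settled case by case. *)
Definition bmfun (d : measure_display) (T : measurableType d) (R : realType)
    (f : T -> R) : Prop :=
  measurable_fun setT f /\ exists M : R, forall x, `|f x| <= M.

Section BoundedMeasurable.
Context (d : measure_display) (T : measurableType d) (R : realType).
Implicit Types f g : T -> R.

Lemma bmfun_cst (c : R) : bmfun (fun _ : T => c).
Proof. by split; [exact: measurable_cst|exists `|c|]. Qed.

Lemma bmfunD f g : bmfun f -> bmfun g -> bmfun (fun x => f x + g x).
Proof.
move=> [mf [M hM]] [mg [K hK]]; split; first exact: measurable_funD.
by exists (M + K) => x; rewrite (le_trans (ler_normD _ _))// lerD.
Qed.

Lemma bmfunN f : bmfun f -> bmfun (fun x => - f x).
Proof.
move=> [mf [M hM]]; split; first exact: measurableT_comp.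
by exists M => x; rewrite normrN.
Qed.

Lemma bmfunB f g : bmfun f -> bmfun g -> bmfun (fun x => f x - g x).
Proof. by move=> hf hg; apply: bmfunD => //; exact: bmfunN. Qed.

Lemma bmfunM f g : bmfun f -> bmfun g -> bmfun (fun x => f x * g x).
Proof.
move=> [mf [M hM]] [mg [K hK]]; split; first exact: measurable_funM.
by exists (M * K) => x; rewrite normrM ler_pM.
Qed.

Lemma bmfunX f n : bmfun f -> bmfun (fun x => f x ^+ n).
Proof.
move=> hf; elim: n => [|n IH]; first exact: bmfun_cst.
by under eq_fun do rewrite exprS; exact: bmfunM.
Qed.

Lemma bmfun_norm f : bmfun f -> bmfun (fun x => `|f x|).
Proof.
move=> [mf [M hM]]; split; first exact: measurableT_comp.
by exists M => x; rewrite normr_id.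
Qed.

Lemma bmfun_sum (I : Type) (r : seq I) (F : I -> T -> R) :
  (forall i, bmfun (F i)) -> bmfun (fun x => \sum_(i <- r) F i x).
Proof.
move=> hF; elim: r => [|i r IH].
  by under eq_fun do rewrite big_nil; exact: bmfun_cst.
by under eq_fun do rewrite big_cons; exact: bmfunD.
Qed.

Lemma bmfun_comp (d' : measure_display) (T' : measurableType d') f
    (h : T' -> T) :
  measurable_fun setT h -> bmfun f -> bmfun (fun x => f (h x)).
Proof.
move=> mh [mf [M hM]]; split; last by exists M.
exact: measurableT_comp.
Qed.

End BoundedMeasurable.

Section Mean.
Context (d : measure_display) (T : measurableType d) (R : realType)
  (U : probability T R).
Implicit Types f g : T -> R.

Definition mean f : R := \int[U]_x f x.

Lemma bmfun_integrable f : bmfun f -> U.-integrable setT (EFin \o f).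
Proof.
move=> [mf [M hM]]; apply: measurable_bounded_integrable => //.
  by rewrite -ge0_fin_numE// fin_num_measure.
exists M; split; first exact: num_real.
by move=> K MK x _; exact: le_trans (hM x) (ltW MK).
Qed.

Lemma EFin_mean f : bmfun f -> (mean f)%:E = (\int[U]_x (f x)%:E)%E.
Proof.
move=> hf; rewrite /mean /Rintegral fineK//.
exact/integrable_fin_num/bmfun_integrable.
Qed.

Lemma eq_mean f g : f =1 g -> mean f = mean g.
Proof. by move=> /funext ->. Qed.

Lemma mean_cst c : mean (fun _ => c) = c.
Proof.
rewrite /mean Rintegral_cst// -[RHS]mulr1; congr (_ * _).
by rewrite -[RHS]/(fine 1%E); congr fine; exact: probability_setT.
Qed.

Lemma meanD f g : bmfun f -> bmfun g ->
  mean (fun x => f x + g x) = mean f + mean g.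
Proof. by move=> hf hg; rewrite /mean RintegralD//; exact: bmfun_integrable. Qed.

Lemma meanB f g : bmfun f -> bmfun g ->
  mean (fun x => f x - g x) = mean f - mean g.
Proof. by move=> hf hg; rewrite /mean RintegralB//; exact: bmfun_integrable. Qed.

Lemma meanZ c f : bmfun f -> mean (fun x => c * f x) = c * mean f.
Proof. by move=> hf; rewrite /mean RintegralZl//; exact: bmfun_integrable. Qed.

Lemma le_mean f g : bmfun f -> bmfun g -> (forall x, f x <= g x) ->
  mean f <= mean g.
Proof.
by move=> hf hg fg; apply: le_Rintegral => //; exact: bmfun_integrable.
Qed.

Lemma mean_ge0 f : (forall x, 0 <= f x) -> 0 <= mean f.
Proof. by move=> f0; apply: Rintegral_ge0. Qed.

Lemma mean_sum (I : Type) (r : seq I) (F : I -> T -> R) :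
  (forall i, bmfun (F i)) ->
  mean (fun x => \sum_(i <- r) F i x) = \sum_(i <- r) mean (F i).
Proof.
move=> hF; elim: r => [|i r IH].
  by rewrite big_nil; under eq_mean do rewrite big_nil; exact: mean_cst.
rewrite big_cons -IH -meanD//; last exact: bmfun_sum.
by apply: eq_mean => x; rewrite big_cons.
Qed.

Lemma norm_mean f (M : R) : bmfun f -> (forall x, `|f x| <= M) -> `|mean f| <= M.
Proof.
move=> hf hM; rewrite -(mean_cst M).
apply: le_trans (le_normr_Rintegral _ (bmfun_integrable hf)) _ => //.
by apply: le_mean => //; [exact: bmfun_norm|exact: bmfun_cst].
Qed.

End Mean.

(** * Exchanging means over two variables *)

Section Fubini.
Context (d1 d2 : measure_display) (T1 : measurableType d1)
  (T2 : measurableType d2) (R : realType)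
  (U1 : probability T1 R) (U2 : probability T2 R).

Lemma bmfun_xsection (f : T1 -> T2 -> R) x :
  bmfun (fun z : T1 * T2 => f z.1 z.2) -> bmfun (f x).
Proof. exact: (bmfun_comp (pair1_measurable x)). Qed.

Lemma bmfun_ysection (f : T1 -> T2 -> R) y :
  bmfun (fun z : T1 * T2 => f z.1 z.2) -> bmfun (f ^~ y).
Proof. exact: (bmfun_comp (pair2_measurable y)). Qed.

Lemma bmfun_mean (f : T1 -> T2 -> R) :
  bmfun (fun z : T1 * T2 => f z.1 z.2) -> bmfun (fun x => mean U2 (f x)).
Proof.
move=> hf; have [mf [M hM]] := hf; split; last first.
  exists M => x; apply: norm_mean; first exact: bmfun_xsection.
  by move=> y; exact: (hM (x, y)).
apply/measurable_EFinP.
have -> : EFin \o (fun x => mean U2 (f x)) =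
    fubini_F U2 (fun z => (f z.1 z.2)%:E).
  by apply/funext => x /=; rewrite EFin_mean//; exact: bmfun_xsection.
apply: (measurable_fubini_F (m1 := U1)).
exact: (bmfun_integrable (U1 \x U2)%E).
Qed.
End Fubini.

Lemma mean_Fubini (d1 d2 : measure_display) (T1 : measurableType d1)
  (T2 : measurableType d2) (R : realType)
  (U1 : probability T1 R) (U2 : probability T2 R) (f : T1 -> T2 -> R) :
  bmfun (fun z : T1 * T2 => f z.1 z.2) ->
  mean U1 (fun x => mean U2 (f x)) = mean U2 (fun y => mean U1 (f ^~ y)).
Proof.
move=> hf; apply: EFin_inj.
have hf' : bmfun (fun z : T2 * T1 => f z.2 z.1).
  apply: (bmfun_comp _ hf (h := fun z => (z.2, z.1))).
  exact: measurable_fun_pair.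
rewrite !EFin_mean//; last 2 first.
- exact: (bmfun_mean U2 U1 hf').
- exact: (bmfun_mean U1 U2 hf).
transitivity (\int[U1]_x \int[U2]_y (f x y)%:E)%E.
  by apply: eq_integral => x _; rewrite EFin_mean//; exact: bmfun_xsection hf.
rewrite (Fubini (f := fun z => (f z.1 z.2)%:E)) /=.
  by apply: eq_integral => y _; rewrite EFin_mean//; exact: bmfun_ysection hf.
exact: (bmfun_integrable (U1 \x U2)%E).
Qed.

(** * Translations and dilations of the circle *)

Section Translation.
Context (R : realType).

Lemma measurable_floor : measurable_fun setT (fun x : R => (Num.floor x)%:~R : R).
Proof. by apply: nondecreasing_measurable => // x y xy; rewrite ler_int le_floor. Qed.

Definition addr_of (t x : R) : R := x + t.

Lemma measurable_addr_of t : measurable_fun setT (addr_of t).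
Proof. exact: measurable_funD. Qed.

HB.instance Definition _ t :=
  isMeasurableFun.Build _ _ _ _ (addr_of t) (measurable_addr_of t).

(** Lebesgue measure is determined by its values on half-open intervals, and there the pushforward
    agrees with it. *)
Lemma lebesgue_measureD (t : R) (A : set R) : measurable A ->
  lebesgue_measure (addr_of t @^-1` A) = lebesgue_measure A.
Proof.
move=> mA; apply/esym.
apply: (@lebesgue_measure_unique R
  (pushforward lebesgue_measure (addr_of t : R -> measurableTypeR R))) => //.
  exact: measurable_addr_of.
move=> mt _ [[a b]] _ <-; rewrite /pushforward.
transitivity (lebesgue_measure (`](a - t), (b - t)]%classic : set R)); last first.
  congr (lebesgue_measure _).
  by apply/seteqP; split => x /=; rewrite /addr_of !in_itv/= ltrBlDr lerBrDr.
rewrite !lebesgue_measure_itv/= !lte_fin ltrD2r -!EFinB.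
by congr (if _ then (_)%:E else _); lra.
Qed.

(** The fractional part of [x + t]: rotation of the circle seen in the fundamental domain [0, 1). *)
Definition rotate (t x : R) : R := x + t - (Num.floor (x + t))%:~R.

Lemma measurable_rotate t : measurable_fun setT (rotate t).
Proof.
apply: measurable_funB; first exact: measurable_funD.
apply: (measurableT_comp measurable_floor); exact: measurable_funD.
Qed.

HB.instance Definition _ t :=
  isMeasurableFun.Build _ _ _ _ (rotate t) (measurable_rotate t).

(** Cutting [0, 1) at [1 - t] splits the rotation into two translations, by [t] onto [t, 1) and by
    [t - 1] onto [0, t). *)
Lemma lebesgue_measure_rotate (t : R) (A : set R) : 0 <= t < 1 -> measurable A ->
  lebesgue_measure (rotate t @^-1` A `&` `[0, 1[) =
  lebesgue_measure (A `&` `[0, 1[).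
Proof.
move=> /andP[t0 t1] mA.
have mitv (a b : R) : measurable (A `&` `[a, b[) by exact: measurableI.
have E1 : rotate t @^-1` A `&` `[0, 1[ =
    (addr_of t @^-1` (A `&` `[t, 1[)) `|` (addr_of (t - 1) @^-1` (A `&` `[0, t[)).
  apply/seteqP; split => x /=; rewrite /rotate /addr_of !in_itv/=.
    move=> [Ax /andP[x0 x1]]; have [xt|xt] := ltP (x + t) 1.
      left; split; last by lra.
      by move: Ax; rewrite (@floor_def _ _ 0) ?subr0//; lra.
    right; split; last by lra.
    rewrite addrA; move: Ax; rewrite (@floor_def _ _ 1)//.
    by rewrite xt/= intrD; lra.
  move=> [] [Ax /andP[x0 x1]]; split; try lra.
    by rewrite (@floor_def _ _ 0) ?subr0//; lra.
  by rewrite (@floor_def _ _ 1) ?intrD -?addrA//; lra.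
have mU (B C : set R) : measurable B -> measurable C -> B `&` C = set0 ->
    lebesgue_measure (B `|` C) = (lebesgue_measure B + lebesgue_measure C)%E.
  by move=> mB mC; exact: (measureU (@lebesgue_measure R) mB mC).
rewrite E1 mU; last 3 first.
- by rewrite -[_ @^-1` _]setTI; exact: measurable_addr_of.
- by rewrite -[_ @^-1` _]setTI; exact: measurable_addr_of.
- apply/seteqP; split => x //=; rewrite /addr_of !in_itv/=.
  by move=> [[_ /andP[? ?]] [_ /andP[? ?]]]; lra.
rewrite !lebesgue_measureD// -mU//; last first.
  by apply/seteqP; split => x //=; rewrite !in_itv/= => -[[_ ?] [_ ?]]; lra.
rewrite -setIUr setUC; congr (lebesgue_measure (_ `&` _)).
apply/seteqP; split => x //=; rewrite !in_itv/=; first by case=> ?; lra.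
by move=> /andP[x0 x1]; have [?|?] := ltP x t; [left|right]; lra.
Qed.

End Translation.

(** The condition of [uniform01] for a law on the line: the same [U] serves for the offset y and for
    alpha. *)
Definition uniform_law (R : realType) (U : probability R R) : Prop :=
  forall A : set R, measurable A ->
    U A = lebesgue_measure (A `&` `[0, 1[%classic).

Section Periodic.
Context (R : realType) (U : probability R R) (hU : uniform_law U).

Definition periodic1 (f : R -> R) := forall x, f (x + 1) = f x.

Lemma periodic1_nat f n x : periodic1 f -> f (x + n%:R) = f x.
Proof.
move=> pf; elim: n => [|n IH]; first by rewrite addr0.
by rewrite -natr1 addrA pf.
Qed.

Lemma periodic1_int f (k : int) x : periodic1 f -> f (x + k%:~R) = f x.
Proof.
move=> pf; case: k => n; first exact: periodic1_nat.
by rewrite NegzE mulrNz -[in RHS](subrK n.+1%:R x) periodic1_nat.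
Qed.

(** For 0 <= t < 1, periodicity turns the translation into a rotation, which preserves [U]; other
    [t] reduce to this by removing the integer part. *)
Lemma mean_shift (f : R -> R) (t : R) : bmfun f -> periodic1 f ->
  mean U (fun x => f (x + t)) = mean U f.
Proof.
move=> hf pf; wlog /andP[t0 t1] : t / 0 <= t < 1.
  move=> H; rewrite -(H (t - (Num.floor t)%:~R)); last first.
    by have := floor_itv t; rewrite intrD; lra.
  by apply: eq_mean => x; rewrite -(periodic1_int (- Num.floor t) _ pf) addrA mulrNz.
have -> : mean U (fun x => f (x + t)) = mean U (fun x => f (rotate t x)).
  by apply: eq_mean => x; rewrite -(periodic1_int (- Num.floor (x + t)) _ pf) mulrNz.
apply: EFin_inj.
have hft : bmfun (f \o rotate t) by exact: bmfun_comp (measurable_rotate t) hf.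
rewrite !EFin_mean//.
transitivity (\int[pushforward U (rotate t)]_x (f x)%:E)%E.
  rewrite (integral_pushforward (measurable_rotate t))//=.
    by apply/measurable_EFinP; case: hf.
  exact: bmfun_integrable hft.
apply: eq_measure_integral => A mA _.
have mA' : measurable (rotate t @^-1` A).
  by rewrite -[_ @^-1` _]setTI; exact: measurable_rotate.
by rewrite [RHS]hU// -(lebesgue_measure_rotate (t := t)) ?t0// -hU.
Qed.

(* Averaging [f (q x + y)] over both variables and translating [x] by [y / q]
   or [y] by [q x] reduces dilations to translations. *)
Lemma mean_dilate (f : R -> R) (q : nat) (t : R) : (0 < q)%N -> bmfun f ->
  periodic1 f -> mean U (fun x : R => f (x * q%:R + t)) = mean U f.
Proof.
move=> q0 hf pf; have qn0 : q%:R != 0 :> R by rewrite pnatr_eq0 -lt0n.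
have mq s : measurable_fun setT (fun x : R => x * q%:R + s).
  by apply: measurable_funD => //; exact: measurable_funM.
have pq : periodic1 (fun x : R => f (x * q%:R)).
  by move=> x; rewrite mulrDl mul1r periodic1_nat.
have hq : bmfun (fun x : R => f (x * q%:R)).
  by apply: (bmfun_comp _ hf); exact: measurable_funM.
have E s : mean U (fun x : R => f (x * q%:R + s)) = mean U (fun x : R => f (x * q%:R)).
  rewrite -[RHS](mean_shift (s / q%:R))//; apply: eq_mean => x.
  by rewrite mulrDl divfK.
rewrite E -[LHS](mean_cst U).
transitivity (mean U (fun y => mean U (fun x : R => f (x * q%:R + y)))).
  by apply: eq_mean => y; rewrite E.
rewrite -(mean_Fubini U U (f := fun x y : R => f (x * q%:R + y))).
  rewrite -[RHS](mean_cst U); apply: eq_mean => x.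
  rewrite -(mean_shift (x * q%:R) hf pf).
  by apply: eq_mean => y; rewrite addrC.
apply: (bmfun_comp _ hf (h := fun z : R * R => z.1 * q%:R + z.2)).
by apply: measurable_funD => //; exact: measurable_funM.
Qed.

End Periodic.

(** * The second moment of the discrepancy *)

Section Sawtooth.
Context (R : realType).
Implicit Types x y h a : R.

(** The fractional part of [- x]. Its increment from x to x + h is the number of integers in [x, x +
    h) minus h, for h >= 0. *)
Definition saw x : R := (Num.ceil x)%:~R - x.

Lemma saw_ge0 x : 0 <= saw x.
Proof. by rewrite subr_ge0 ceil_ge. Qed.

Lemma saw_lt1 x : saw x < 1.
Proof. by rewrite /saw; have := ceilB1_lt x; rewrite intrB; lra. Qed.

Lemma saw_periodic : periodic1 saw.
Proof. by move=> x; rewrite /saw ceilDrz// ceil1 intrD; lra. Qed.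

Lemma bmfun_saw : bmfun saw.
Proof.
split; last by exists 1 => x; rewrite ger0_norm ?saw_ge0// ltW// saw_lt1.
apply: measurable_funB => //; apply: nondecreasing_measurable => // x y xy.
by rewrite ler_int le_ceil.
Qed.

Definition sawinc h x : R := saw (x + h) - saw x.

Lemma sawincE h x :
  sawinc h x = (Num.ceil (x + h))%:~R - (Num.ceil x)%:~R - h.
Proof. by rewrite /sawinc /saw; lra. Qed.

Lemma sawinc_periodic h : periodic1 (sawinc h).
Proof. by move=> x; rewrite /sawinc [x + 1 + h]addrAC !saw_periodic. Qed.

Lemma bmfun_sawinc h : bmfun (sawinc h).
Proof.
apply: (bmfunB (f := fun x => saw (x + h)) _ bmfun_saw).
by apply: (bmfun_comp _ bmfun_saw); exact: measurable_funD.
Qed.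

Lemma sawinc_ge h x : 0 <= h -> - h <= sawinc h x.
Proof.
move=> h0; rewrite sawincE -[leLHS]add0r lerD2r subr_ge0 ler_int le_ceil//.
by rewrite lerDl.
Qed.

(** The increment d lies in (-1, 1) and d >= -h, so d^2 <= |d| <= d + 2 h. This bound is linear in
    d, which has mean 0, and so yields a mean square of at most 2 h. *)
Lemma sqr_sawinc_le h x : 0 <= h -> sawinc h x ^+ 2 <= sawinc h x + 2 * h.
Proof.
move=> h0; have := sawinc_ge x h0; rewrite /sawinc.
have := saw_ge0 x; have := saw_lt1 x; have := saw_ge0 (x + h).
have := saw_lt1 (x + h); set u := saw _; set v := saw x => *.
by have [?|?] := leP 0 (u - v); nra.
Qed.

Definition sawsum (N : nat) a y : R :=
  \sum_(i < N) saw (y - a * i.+1%:R ^+ 2).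

(* The number of pairs (n, k), 1 <= n <= N and k an integer, with
   y <= a n ^ 2 + k < y + h, minus N h; for h > 1 a single n is counted with
   multiplicity. *)
Definition discr (N : nat) h a y : R := sawsum N a (y + h) - sawsum N a y.

Lemma discrE N h a y :
  discr N h a y = \sum_(i < N) sawinc h (y - a * i.+1%:R ^+ 2).
Proof.
rewrite /discr /sawsum -sumrB; apply: eq_bigr => i _.
by rewrite /sawinc [y + h - _]addrAC.
Qed.

Lemma sawsum_periodic N a : periodic1 (sawsum N a).
Proof. by move=> y; apply: eq_bigr => i _; rewrite [y + 1 - _]addrAC saw_periodic. Qed.

Lemma discr_ge N h a y : 0 <= h -> - (N%:R * h) <= discr N h a y.
Proof.
move=> h0; rewrite discrE -mulrN -[N in N%:R]card_ord mulr_natl -sumr_const.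
by apply: ler_sum => i _; exact: sawinc_ge.
Qed.

Lemma measurable_orbit (c : R) :
  measurable_fun setT (fun z : R * R => z.2 - z.1 * c).
Proof. by apply: measurable_funB => //; exact: measurable_funM. Qed.

Lemma bmfun_discr2 N h : bmfun (fun z : R * R => discr N h z.1 z.2).
Proof.
under eq_fun do rewrite discrE.
apply: bmfun_sum => i; exact: (bmfun_comp (measurable_orbit _) (bmfun_sawinc h)).
Qed.

Lemma bmfun_discr N h a : bmfun (discr N h a).
Proof. exact: bmfun_xsection (bmfun_discr2 N h). Qed.

Context (U : probability R R) (hU : uniform_law U).

Lemma mean_sawinc h : mean U (sawinc h) = 0.
Proof.
rewrite meanB ?(mean_shift hU h bmfun_saw saw_periodic) ?subrr//.
  by apply: (bmfun_comp _ bmfun_saw); exact: measurable_funD.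
exact: bmfun_saw.
Qed.

Lemma mean_sqr_sawinc h : 0 <= h -> mean U (fun x => sawinc h x ^+ 2) <= 2 * h.
Proof.
move=> h0; apply: (@le_trans _ _ (mean U (fun x => sawinc h x + 2 * h))).
  apply: le_mean => [||x]; [| |exact: sqr_sawinc_le].
    by apply: bmfunX; exact: bmfun_sawinc.
  by apply: bmfunD; [exact: bmfun_sawinc|exact: bmfun_cst].
rewrite meanD ?mean_sawinc ?mean_cst ?add0r//; last exact: bmfun_cst.
exact: bmfun_sawinc.
Qed.

Lemma mean_discr N h a : mean U (discr N h a) = 0.
Proof.
transitivity (mean U (fun y =>
    \sum_(i < N) sawinc h (y - a * i.+1%:R ^+ 2))).
  by apply: eq_mean => y; rewrite discrE.
rewrite mean_sum => [|i]; last first.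
  by apply: (bmfun_comp _ (bmfun_sawinc h)); exact: measurable_funB.
rewrite big1// => i _.
by rewrite (mean_shift hU (- _) (bmfun_sawinc h) (sawinc_periodic h)) mean_sawinc.
Qed.

(** Pairwise independence. A shift of y leaves [a] only in the factor at [a * q + y] with q = j^2 -
    i^2 > 0; dilation invariance in [a] then produces the mean of [sawinc], which is 0. *)
Lemma mean_sawinc_cross h (i j : nat) : (i < j)%N ->
  mean U (fun a => mean U (fun y =>
    sawinc h (y - a * i%:R ^+ 2) * sawinc h (y - a * j%:R ^+ 2))) = 0.
Proof.
move=> ij; set g := sawinc h.
have hg : bmfun g := bmfun_sawinc h; have pg : periodic1 g := @sawinc_periodic h.
pose q := (j ^ 2 - i ^ 2)%N.
have q0 : (0 < q)%N by rewrite subn_gt0 ltn_exp2r.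
have qE : q%:R = j%:R ^+ 2 - i%:R ^+ 2 :> R.
  by rewrite natrB ?natrX// leq_exp2r// ltnW.
have E a : mean U (fun y => g (y - a * i%:R ^+ 2) * g (y - a * j%:R ^+ 2)) =
    mean U (fun y => g (a * q%:R + y) * g y).
  rewrite -(mean_shift hU (- (a * j%:R ^+ 2)) (f := fun y => g (a * q%:R + y) * g y)).
  - apply: eq_mean => y; congr (g _ * g _).
    by rewrite qE; ring.
  - apply: bmfunM; last exact: hg.
    by apply: (bmfun_comp _ hg); exact: measurable_funD.
  - by move=> y; rewrite addrA !pg.
under eq_mean do rewrite E.
rewrite (mean_Fubini U U (f := fun a y : R => g (a * q%:R + y) * g y)).
  rewrite -[RHS](mean_cst U); apply: eq_mean => y.
  have hgq : bmfun (fun a : R => g (a * q%:R + y)).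
    by apply: (bmfun_comp _ hg); apply: measurable_funD => //; exact: measurable_funM.
  transitivity (mean U (fun a => g y * g (a * q%:R + y))).
    by apply: eq_mean => a; rewrite mulrC.
  by rewrite meanZ// mean_dilate// mean_sawinc mulr0.
apply: bmfunM.
  apply: (bmfun_comp _ hg (h := fun z : R * R => z.1 * q%:R + z.2)).
  by apply: measurable_funD => //; exact: measurable_funM.
exact: (bmfun_comp _ hg (h := snd)).
Qed.

(** After expanding the square, the off-diagonal terms vanish and each of the N diagonal terms is at
    most 2 h. *)
Lemma second_moment N h : 0 <= h ->
  mean U (fun a => mean U (fun y => discr N h a y ^+ 2)) <= 2 * N%:R * h.
Proof.
move=> h0.
pose G (i j : 'I_N) (a y : R) :=
  sawinc h (y - a * i.+1%:R ^+ 2) * sawinc h (y - a * j.+1%:R ^+ 2).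
have hG i j : bmfun (fun z : R * R => G i j z.1 z.2).
  apply: bmfunM; exact: (bmfun_comp (measurable_orbit _) (bmfun_sawinc h)).
have -> : mean U (fun a => mean U (fun y => discr N h a y ^+ 2)) =
    \sum_(i < N) \sum_(j < N) mean U (fun a => mean U (G i j a)).
  transitivity (mean U (fun a => \sum_(i < N) \sum_(j < N) mean U (G i j a))).
    apply: eq_mean => a.
    have hGa i j : bmfun (G i j a) by exact: (bmfun_xsection a (hG i j)).
    transitivity (mean U (fun y => \sum_(i < N) \sum_(j < N) G i j a y)).
      apply: eq_mean => y; rewrite discrE expr2 mulr_suml.
      by apply: eq_bigr => i _; rewrite mulr_sumr.
    rewrite mean_sum; last by move=> i; exact: bmfun_sum.
    by apply: eq_bigr => i _; rewrite mean_sum.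
  rewrite mean_sum => [|i]; last first.
    by apply: bmfun_sum => j; exact: (bmfun_mean U U).
  by apply: eq_bigr => i _; rewrite mean_sum// => j; exact: (bmfun_mean U U).
apply: (@le_trans _ _ (\sum_(i < N) 2 * h)); last first.
  by rewrite sumr_const card_ord -[leLHS]mulr_natl; lra.
apply: ler_sum => i _; rewrite (bigD1 i)//= big1 ?addr0 => [|j ji].
  rewrite -[leRHS](mean_cst U); apply: le_mean => [| |a].
  - exact: (bmfun_mean U U).
  - exact: bmfun_cst.
  - rewrite -[leRHS](mean_cst U) mean_cst.
    apply: le_trans (mean_sqr_sawinc h0).
    rewrite -(mean_shift hU (- (a * i.+1%:R ^+ 2)) (f := fun x => sawinc h x ^+ 2)) //.
      by apply: bmfunX; exact: bmfun_sawinc.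
    by move=> x; rewrite sawinc_periodic.
have [ij|ij|ij] := ltngtP i j; last by move: ji; rewrite (val_inj ij) eqxx.
- by rewrite mean_sawinc_cross.
- under eq_mean => a do under eq_mean => y do rewrite /G mulrC.
  by rewrite mean_sawinc_cross.
Qed.

End Sawtooth.

(** * Almost every alpha *)

(** The sum of the series has integral at most [K], hence is finite almost everywhere, and it
    dominates each of its nonnegative terms. *)
Lemma ae_bounded_of_summable (d : measure_display) (T : measurableType d)
    (R : realType) (U : probability T R) (F : nat -> T -> R) (K : R) :
  (forall j, bmfun (F j)) -> (forall j x, 0 <= F j x) ->
  (forall n, \sum_(0 <= j < n) mean U (F j) <= K) ->
  {ae U, forall x, exists C, forall j, F j x <= C}.
Proof.
move=> hF F0 FK.
have mF j : measurable_fun setT (fun x => (F j x)%:E).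
  by apply/measurable_EFinP; case: (hF j).
have F0E j x : (0 <= (F j x)%:E)%E by rewrite lee_fin.
pose S x := (\sum_(0 <= j <oo) (F j x)%:E)%E.
have S0 x : (0 <= S x)%E by exact: nneseries_ge0.
have iS : U.-integrable setT S.
  apply/integrableP; split; first exact: ge0_emeasurable_sum.
  under eq_integral do rewrite gee0_abs//.
  rewrite integral_nneseries//.
  apply: (@le_lt_trans _ _ K%:E); last exact: ltry.
  apply: lime_le.
    by apply: is_cvg_nneseries => n _ _; apply: integral_ge0 => x _.
  apply: nearW => n; have := FK n; rewrite -lee_fin; apply: le_trans.
  rewrite -sumEFin.
  by under [leRHS]eq_bigr do rewrite EFin_mean//.
have := integrable_ae measurableT iS.
apply: filterS => x /(_ I) Sx; exists (fine (S x)) => j.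
rewrite -lee_fin fineK//.
apply: le_trans (nneseries_lim_ge j.+1 _) => //.
by rewrite big_nat_recr//= leeDr// sume_ge0.
Qed.

(** [U] is Lebesgue measure on [0, 1); the endpoint 1 only adds a null set. *)
Lemma uniform_law_ae (R : realType) (U : probability R R) (Q : R -> Prop) :
  uniform_law U -> {ae U, forall a, Q a} ->
  {ae (@lebesgue_measure R), forall a : R, 0 <= a <= 1 -> Q a}.
Proof.
move=> hU [A [mA UA0 QA]].
exists ((A `&` `[0, 1[) `|` [set 1]); split.
- by apply: measurableU => //; exact: measurableI.
- apply/eqP; rewrite eq_le measure_ge0 andbT.
  apply: (le_trans (measureU2 _ _ _)) => //; first exact: measurableI.
  rewrite [X in (_ + X)%E](_ : _ = 0%E); last exact: lebesgue_measure_set1.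
  by rewrite adde0 [leLHS](_ : _ = 0%E)// -UA0 hU.
- move=> a /= /not_implyP[/andP[a0 a1] nQ].
  have [->|an1] := eqVneq a 1; [by right|left; split; first exact: QA].
  by rewrite /= in_itv/= a0 lt_neqAle an1.
Qed.

(** The correction [- n%:R^-1] lets the induction close, as 1/(n+1)^2 <= 1/n - 1/(n+1) for n >=
    1. *)
Lemma sum_inv_sqr_le2 (R : realType) n :
  \sum_(0 <= j < n) (j.+1%:R ^+ 2)^-1 <= 2 - n%:R^-1 :> R.
Proof.
elim: n => [|[|n] IH]; first by rewrite big_nil invr0; lra.
  (* The telescoping fails from 0 to 1 because [0^-1 = 0], so n = 1 is checked directly. *)
  by rewrite big_nat1 expr1n invr1; lra.
rewrite big_nat_recr//=; apply: (le_trans (lerD IH (lexx _))).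
have n0 : 0 < n.+1%:R :> R by rewrite ltr0n.
rewrite -[n.+2%:R]natr1; set x : R := n.+1%:R in n0 *.
rewrite -subr_ge0.
have -> : 2 - (x + 1)^-1 - (2 - x^-1 + ((x + 1) ^+ 2)^-1) = (x * (x + 1) ^+ 2)^-1.
  by field; rewrite !gt_eqF//; lra.
by rewrite invr_ge0 mulr_ge0 ?sqr_ge0// ltW.
Qed.

(** * Mean squares bounded for almost every alpha *)

Section Variance.
Context (R : realType) (U : probability R R) (hU : uniform_law U).

(** As [discr] has mean 0 in y, this is the variance of the count at fixed [a]. *)
Definition vari (N : nat) (h a : R) : R := mean U (fun y => discr N h a y ^+ 2).

Lemma vari_ge0 N h a : 0 <= vari N h a.
Proof. by apply: mean_ge0 => y; exact: sqr_ge0. Qed.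

Lemma bmfun_vari N h : bmfun (vari N h).
Proof.
apply: (bmfun_mean U U (f := fun a y => discr N h a y ^+ 2)).
exact: bmfunX (bmfun_discr2 N h).
Qed.

(** Dividing by N h (j+1)^3 and summing over at most K (j+1) lengths leaves a mean of at most 2 K /
    (j+1)^2, summable in j. So the normalised sums are bounded for almost every [a], and with them
    each term. *)
Lemma ae_vari_le (N : nat -> nat) (H : nat -> seq R) (K : nat) :
  (forall j, (0 < N j)%N) -> (forall j h, h \in H j -> 0 < h) ->
  (forall j, (size (H j) <= K * j.+1)%N) ->
  {ae U, forall a, exists C, forall j h, h \in H j ->
    vari (N j) h a <= C * (N j)%:R * j.+1%:R ^+ 3 * h}.
Proof.
move=> N0 H0 sH.
pose w j : R := ((N j)%:R * j.+1%:R ^+ 3)^-1.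
have w0 j : 0 < w j.
  by rewrite invr_gt0 mulr_gt0 ?ltr0n// exprn_gt0 ?ltr0n.
(* The filter [h \in H j] hands the positivity of [h] to each term of the sum. *)
pose F j a : R := w j * \sum_(h <- H j | h \in H j) (h^-1 * vari (N j) h a).
have hV j h : bmfun (fun a => h^-1 * vari (N j) h a).
  by apply: bmfunM; [exact: bmfun_cst|exact: bmfun_vari].
have FE j : F j = fun a => w j * \sum_(h <- [seq h <- H j | h \in H j])
    (h^-1 * vari (N j) h a).
  by apply/funext => a; rewrite big_filter.
have hF j : bmfun (F j).
  rewrite FE; apply: bmfunM; first exact: bmfun_cst.
  by apply: bmfun_sum => h; exact: hV.
have F0 j a : 0 <= F j a.
  rewrite mulr_ge0 ?(ltW (w0 _))//; apply: sumr_ge0 => h hH.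
  by rewrite mulr_ge0 ?vari_ge0// invr_ge0 ltW// (H0 j).
have mF j : mean U (F j) <= 2 * K%:R * (j.+1%:R ^+ 2)^-1.
  rewrite FE meanZ; last by apply: bmfun_sum => h; exact: hV.
  rewrite mean_sum; last by move=> h; exact: hV.
  apply: (@le_trans _ _ (w j * ((2 * (N j)%:R) * (K * j.+1)%:R))).
    rewrite ler_pM2l//.
    apply: (@le_trans _ _ (\sum_(h <- [seq h <- H j | h \in H j]) (2 * (N j)%:R))).
      rewrite !big_filter; apply: ler_sum => h hH; have h0 := H0 _ _ hH.
      rewrite meanZ; last exact: bmfun_vari.
      rewrite mulrC ler_pdivrMr//; exact: second_moment (ltW h0).
    rewrite big_const_seq iter_addr_0 -[leLHS]mulr_natr ler_wpM2l ?mulr_ge0//.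
    rewrite ler_nat (leq_trans (count_size _ _))//.
    by rewrite size_filter (leq_trans (count_size _ _)).
  rewrite le_eqVlt; apply/orP; left; apply/eqP; rewrite /w natrM; field.
  by rewrite nat1r !pnatr_eq0 -!lt0n N0.
have := ae_bounded_of_summable hF F0 (U := U) (K := 2 * K%:R * 2).
have FK n : \sum_(0 <= j < n) mean U (F j) <= 2 * K%:R * 2.
  apply: (le_trans (ler_sum _ (fun j _ => mF j))); rewrite -mulr_sumr.
  rewrite ler_wpM2l ?mulr_ge0//; apply: le_trans (sum_inv_sqr_le2 _ _) _.
  by rewrite gerBl invr_ge0.
move=> /(_ FK); apply: filterS => a [C hC]; exists C => j h hH.
have := hC j; rewrite /F /w mulrC ler_pdivrMr; last first.
  by rewrite mulr_gt0 ?ltr0n// exprn_gt0 ?ltr0n.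
rewrite !mulrA => hj; rewrite -ler_pdivrMr ?(H0 j)// mulrC; apply: le_trans hj.
(* With [h] moved to the front, its term is at most the whole sum, the others being nonnegative. *)
rewrite (perm_big (h :: rem h (H j))) ?perm_to_rem//= big_cons hH lerDl.
apply: sumr_ge0 => h' h'H; rewrite mulr_ge0 ?vari_ge0// invr_ge0 ltW//.
exact: H0 h'H.
Qed.

End Variance.

(** * Chaining: a uniform discrepancy bound *)

Section Chaining.
Context (R : realType).

(** From lam |d| <= d^2 + lam^2. The result is linear in q, so means over the origin can be taken
    directly. *)
Lemma le_sqr_div (d q lam : R) : 0 < lam -> d ^+ 2 <= q ->
  `|d| <= q / lam + lam.
Proof.
move=> lam0 dq; rewrite -real_normK ?num_real// in dq.
rewrite -lerBlDr ler_pdivlMr//; have := normr_ge0 d.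
by move: `|d| dq => u; nra.
Qed.

Lemma le_telescope (T : nat -> R) (B : R) (s r : nat) :
  (forall k, (k < s + r)%N -> `|T k.+1 - T k| <= B) ->
  `|T (s + r)%N - T s| <= r%:R * B.
Proof.
elim: r => [|r IH] hB; first by rewrite addn0 subrr normr0 mul0r.
have -> : T (s + r.+1)%N - T s = (T (s + r.+1)%N - T (s + r)%N) + (T (s + r)%N - T s).
  by lra.
rewrite (le_trans (ler_normD _ _))// -nat1r mulrDl mul1r lerD//.
  by rewrite addnS hB// addnS.
by apply: IH => k kr; apply: hB; rewrite addnS ltnS ltnW.
Qed.

Variables (S : R -> R) (b : nat) (lam y0 : R).
Hypotheses (b0 : (0 < b)%N) (lam0 : 0 < lam).

(** Squared increments of [S] along the grid of mesh b^-i over a unit interval from y. The sum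
    dominates any single one and has a computable mean in y. *)
Definition levelsq (i : nat) (y : R) : R :=
  \sum_(m < b ^ i) (S (y + m.+1%:R * b%:R^-1 ^+ i) - S (y + m%:R * b%:R^-1 ^+ i)) ^+ 2.

Lemma levelsq_ge0 i y : 0 <= levelsq i y.
Proof. by apply: sumr_ge0 => m _; exact: sqr_ge0. Qed.

Lemma chain_step i k : (k < b ^ i)%N ->
  `|S (y0 + k.+1%:R * b%:R^-1 ^+ i) - S (y0 + k%:R * b%:R^-1 ^+ i)|
    <= levelsq i y0 / lam + lam.
Proof.
move=> ki; apply: le_sqr_div => //.
rewrite /levelsq (bigD1 (Ordinal ki))//= lerDl.
by apply: sumr_ge0 => m _; exact: sqr_ge0.
Qed.

(** A point of level i + 1 is reached from the level i grid point at or just below it in m mod b < b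
    steps; induction on the level does the rest. *)
Lemma chain_grid i m : (m <= b ^ i)%N ->
  `|S (y0 + m%:R * b%:R^-1 ^+ i) - S y0|
    <= \sum_(l < i.+1) b%:R * (levelsq l y0 / lam + lam).
Proof.
have bn0 : b%:R != 0 :> R by rewrite pnatr_eq0 -lt0n.
have B0 i' : 0 <= levelsq i' y0 / lam + lam.
  by rewrite addr_ge0 ?(ltW lam0)// divr_ge0 ?levelsq_ge0// ltW.
elim: i m => [|i IH] m mi.
  rewrite big_ord1.
  have Hm := le_telescope (T := fun k => S (y0 + k%:R * b%:R^-1 ^+ 0)) (s := 0)
    (r := m) (fun k km => chain_step (i := 0) (leq_trans km mi)).
  rewrite add0n mul0r addr0 in Hm; apply: (le_trans Hm).
  by rewrite ler_wpM2r// ler_nat (leq_trans mi).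
rewrite big_ord_recr/=; set X := S (y0 + (m %/ b)%:R * b%:R^-1 ^+ i).
have XE : X = S (y0 + (m %/ b * b)%:R * b%:R^-1 ^+ i.+1).
  by rewrite /X exprS natrM mulrA mulfK.
have -> : S (y0 + m%:R * b%:R^-1 ^+ i.+1) - S y0 =
    (X - S y0) + (S (y0 + m%:R * b%:R^-1 ^+ i.+1) - X) by lra.
rewrite (le_trans (ler_normD _ _))// lerD ?IH//.
  by rewrite -(mulKn (b ^ i) b0) -expnS leq_div2r.
have Hm := le_telescope (T := fun k => S (y0 + k%:R * b%:R^-1 ^+ i.+1))
  (s := (m %/ b * b)%N) (r := (m %% b)%N).
rewrite XE {1}(divn_eq m b).
apply: le_trans (Hm (levelsq i.+1 y0 / lam + lam) _) _.
  by move=> k; rewrite -divn_eq => km; apply: chain_step; exact: leq_trans km mi.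
by rewrite ler_wpM2r// ler_nat ltnW// ltn_mod.
Qed.

Hypotheses (pS : periodic1 S) (N : R)
  (dS : forall x z, x <= z -> - (N * (z - x)) <= S z - S x).

(** Modulo 1, [x] lies between two neighbours of the finest grid. As [S] falls at rate at most N,
    the left neighbour bounds S x from below and the right one from above, each up to N b^-i. *)
Lemma chain_sup i x :
  `|S x - S y0| <= \sum_(l < i.+1) b%:R * (levelsq l y0 / lam + lam) +
    N * b%:R^-1 ^+ i.
Proof.
(* [S] takes equal values at 0 and 1, so [dS] between them forces N >= 0. *)
have N0 : 0 <= N.
  have := dS (ler01 : 0 <= 1); rewrite -{2}[1]add0r pS; lra.
wlog /andP[x0 x1] : x / y0 <= x < y0 + 1.
  move=> H; have := H (x + (- Num.floor (x - y0))%:~R).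
  rewrite (periodic1_int _ _ pS); apply.
  by have := floor_itv (x - y0); rewrite mulrNz intrD; lra.
set B := \sum_(l < _) _; set e := b%:R^-1 ^+ i.
have e0 : 0 < e by rewrite exprn_gt0// invr_gt0 ltr0n.
have bi : (b ^ i)%:R * e = 1.
  by rewrite natrX -exprMn divff ?expr1n// pnatr_eq0 -lt0n.
pose m := Num.truncn ((x - y0) / e).
have t0 : 0 <= (x - y0) / e by rewrite divr_ge0 ?(ltW e0)// subr_ge0.
have /andP[m1 m2] : m%:R * e <= x - y0 < m.+1%:R * e.
  by rewrite -ler_pdivlMr// -ltr_pdivrMr//; exact: truncn_itv.
have mi : (m < b ^ i)%N.
  rewrite -(ltr_nat R) -(ltr_pM2r e0) bi; apply: (le_lt_trans m1); lra.
have := chain_grid (ltnW mi); have := chain_grid mi; rewrite -/B -/e => h1 h2.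
have d1 : y0 + m%:R * e <= x by lra.
have d2 : x <= y0 + m.+1%:R * e by lra.
have mE : m.+1%:R * e = m%:R * e + e by rewrite -natr1 mulrDl mul1r.
have {d1} := dS d1; have {d2} := dS d2.
have : N * (x - (y0 + m%:R * e)) <= N * e by rewrite ler_wpM2l//; lra.
have : N * (y0 + m.+1%:R * e - x) <= N * e by rewrite ler_wpM2l//; lra.
move: h1 h2; rewrite !ler_norml => /andP[? ?] /andP[? ?] ? ? ? ?.
by apply/andP; split; lra.
Qed.

End Chaining.

(** * Averaging the chaining bound over the origin *)

Section Sup.
Context (R : realType) (U : probability R R) (hU : uniform_law U).

(** The chaining bound holds from every origin y while the left side does not involve y, so y is
    averaged out and [levelsq] becomes b^l times the variance. The factor 2 accounts for the two
    endpoints x and x + h. *)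
Lemma discr_sup (b A N : nat) (lam h a x : R) : (0 < b)%N -> 0 < lam ->
  `|discr N h a x| <= 2 * (\sum_(l < A.+1)
      b%:R * (b%:R ^+ l * vari U N (b%:R^-1 ^+ l) a / lam + lam) +
    N%:R * b%:R^-1 ^+ A).
Proof.
move=> b0 lam0; set S := sawsum N a.
have pS : periodic1 S := @sawsum_periodic R N a.
have dS u z : u <= z -> - (N%:R * (z - u)) <= S z - S u.
  move=> uz; have := discr_ge N a u (h := z - u).
  by rewrite subr_ge0 => /(_ uz); rewrite /discr [u + _]addrC subrK.
have hS l : bmfun (levelsq S b l).
  apply: bmfun_sum => m; apply: bmfunX.
  pose e : R := b%:R^-1 ^+ l.
  rewrite [X in bmfun X](_ : _ = fun y => discr N e a (y + m%:R * e)).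
    by apply: (bmfun_comp _ (bmfun_discr N e a)); exact: measurable_funD.
  by apply/funext => y; rewrite /discr -/S -addrA -/e -natr1 mulrDl mul1r.
have mS l : mean U (levelsq S b l) = b%:R ^+ l * vari U N (b%:R^-1 ^+ l) a.
  pose e : R := b%:R^-1 ^+ l; have he := bmfun_discr N e a.
  have he2 : bmfun (fun y => discr N e a y ^+ 2) by exact: bmfunX.
  transitivity (\sum_(m < b ^ l)
      mean U (fun y => discr N e a (y + m%:R * e) ^+ 2)).
    rewrite -mean_sum => [|m].
      apply: eq_mean => y; apply: eq_bigr => m _; congr (_ ^+ 2).
      by rewrite /discr -/S -addrA -/e -natr1 mulrDl mul1r.
    by apply: (bmfun_comp _ he2); exact: measurable_funD.
  rewrite (eq_bigr (fun=> vari U N e a)); last first.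
    move=> m _; rewrite (mean_shift hU _ (f := fun y => discr N e a y ^+ 2))//.
    by move=> y; rewrite /discr -/S [y + 1 + _]addrAC !pS.
  by rewrite sumr_const card_ord -[LHS]mulr_natl natrX.
pose B y := \sum_(l < A.+1) b%:R * (levelsq S b l y / lam + lam) +
  N%:R * b%:R^-1 ^+ A.
have hB l : bmfun (fun y => b%:R * (levelsq S b l y / lam + lam)).
  apply: bmfunM; first exact: bmfun_cst.
  apply: bmfunD; last exact: bmfun_cst.
  by apply: bmfunM; [exact: hS|exact: bmfun_cst].
have le_discr_B y : `|discr N h a x| <= 2 * B y.
  have := chain_sup y b0 lam0 pS dS A (x + h).
  have := chain_sup y b0 lam0 pS dS A x.
  rewrite -/(B y) !ler_norml /discr -/S => /andP[? ?] /andP[? ?].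
  by apply/andP; split; lra.
have hBB : bmfun B by apply: bmfunD; [exact: bmfun_sum|exact: bmfun_cst].
have -> : \sum_(l < A.+1) b%:R * (b%:R ^+ l * vari U N (b%:R^-1 ^+ l) a / lam + lam) +
    N%:R * b%:R^-1 ^+ A = mean U B.
  rewrite meanD; [|exact: bmfun_sum|exact: bmfun_cst].
  rewrite mean_cst mean_sum//; congr (_ + _); apply: eq_bigr => l _.
  have hl : bmfun (fun y => levelsq S b l y / lam).
    by apply: bmfunM; [exact: hS|exact: bmfun_cst].
  rewrite meanZ; last by apply: bmfunD => //; exact: bmfun_cst.
  rewrite meanD//; last exact: bmfun_cst.
  rewrite mean_cst -mS; congr (_ * (_ + _)).
  rewrite mulrC -meanZ//; apply: eq_mean => y; exact: mulrC.
rewrite -meanZ// -[leLHS](mean_cst U); apply: le_mean => //.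
  exact: bmfun_cst.
by apply: bmfunM => //; exact: bmfun_cst.
Qed.

End Sup.

(** * The third moment along the grid *)

Section ThirdMoment.
Context (R : realType) (U : probability R R) (hU : uniform_law U).

(** With V for [discr], the linear term of (V + L)^3 has mean 0, the quadratic one gives 3 L E V^2,
    and |V|^3 <= D V^2. *)
Lemma third_moment_le (N : nat) (h a L D : R) : 0 <= L ->
  (forall y, `|discr N h a y| <= D) ->
  `|mean U (fun y => (discr N h a y + L) ^+ 3) - L ^+ 3|
    <= (3 * L + D) * vari U N h a.
Proof.
move=> L0 hD; have hd := bmfun_discr N h a.
have hd2 := bmfunX 2 hd; have hd3 := bmfunX 3 hd.
have hZ c n : bmfun (fun y => c * discr N h a y ^+ n).
  by apply: bmfunM; [exact: bmfun_cst|exact: bmfunX].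
have -> : mean U (fun y => (discr N h a y + L) ^+ 3) =
    mean U (fun y => discr N h a y ^+ 3) + 3 * L * vari U N h a + L ^+ 3.
  transitivity (mean U (fun y => discr N h a y ^+ 3 +
      (3 * L) * discr N h a y ^+ 2 + ((3 * L ^+ 2) * discr N h a y + L ^+ 3))).
    by apply: eq_mean => y; ring.
  have hL1 : bmfun (fun y => (3 * L ^+ 2) * discr N h a y) := hZ _ 1%N.
  rewrite meanD; last 2 first.
  - exact: bmfunD (hd3) (hZ _ 2%N).
  - by apply: bmfunD => //; exact: bmfun_cst.
  rewrite !meanD//; last exact: bmfun_cst.
  have -> : mean U (fun y => 3 * L ^+ 2 * discr N h a y) = 0.
    by rewrite (meanZ U _ hd) (mean_discr hU) mulr0.
  by rewrite (meanZ U _ hd2) mean_cst add0r.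
have v0 : 0 <= vari U N h a by exact: vari_ge0.
rewrite addrK (le_trans (ler_normD _ _))// [leRHS]mulrDl [leRHS]addrC.
rewrite lerD//; last by rewrite ger0_norm// !mulr_ge0.
rewrite -[leRHS]meanZ//.
apply: (le_trans (le_normr_Rintegral _ (bmfun_integrable _ hd3))) => //.
apply: le_mean => [||y]; [exact: bmfun_norm|exact: hZ|].
have -> : `|discr N h a y ^+ 3| = `|discr N h a y| * discr N h a y ^+ 2.
  by rewrite normrX exprS real_normK ?num_real.
by rewrite ler_wpM2r// sqr_ge0.
Qed.

Variables (B : nat) (K : R).
Let A := (4 * B)%N.

(** With L = l^A and D = O(j^(2B+3)), the error (3 L + D) C j^3 L times j is O(L^2 j^4 + L
    j^(2B+7)); the hypothesis K L >= j^(B+4) makes both terms O(L^3). *)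
Lemma grid_third_moment_le (C a : R) (j l : nat) :
  0 <= C -> 0 < K -> (0 < j)%N -> (0 < l)%N ->
  (forall i, (i <= A)%N ->
    vari U (j ^ A) (j%:R^-1 ^+ i) a
      <= C * (j ^ A)%:R * j%:R ^+ 3 * j%:R^-1 ^+ i) ->
  vari U (j ^ A) ((l%:R / j%:R) ^+ A) a
      <= C * (j ^ A)%:R * j%:R ^+ 3 * (l%:R / j%:R) ^+ A ->
  j%:R ^+ (B + 4) <= K * l%:R ^+ A ->
  `|mean U (fun y => (discr (j ^ A) ((l%:R / j%:R) ^+ A) a y + l%:R ^+ A) ^+ 3)
     - (l%:R ^+ A) ^+ 3|
    <= (3 * K * C + (2 * A.+1%:R * (C + 1) + 2) * C * K ^+ 2) / j%:R
       * (l%:R ^+ A) ^+ 3.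
Proof.
(* [e1] serves to bound N j^3 by the square of j^(2B+2), [e2] to bound j^(2B+7) by the square of
   j^(B+4). *)
have e1 : (A + 3 <= 2 * B + 2 + (2 * B + 2))%N by rewrite /A; lia.
have e2 : (2 * B + 7 <= (B + 4) * 2)%N by lia.
move=> C0 K0 j0 l0 hi hl hK.
have jr1 : 1 <= j%:R :> R by rewrite ler1n.
have jr0 : 0 < j%:R :> R by rewrite ltr0n.
have L0 : 0 < l%:R ^+ A :> R by rewrite exprn_gt0// ltr0n.
set h := (l%:R / j%:R) ^+ A in hl *; set L := l%:R ^+ A in L0 hK *.
have NhL : (j ^ A)%:R * h = L by rewrite natrX -exprMn mulrC divfK// gt_eqF.
set x := j%:R in jr1 jr0 hi hl hK *.
have vL : vari U (j ^ A) h a <= C * x ^+ 3 * L.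
  apply: (le_trans hl); rewrite -NhL.
  have -> : C * (j ^ A)%:R * x ^+ 3 * h = C * x ^+ 3 * ((j ^ A)%:R * h) by ring.
  exact: lexx.
pose C1 : R := 2 * A.+1%:R * (C + 1) + 2.
have C10 : 0 <= C1 by rewrite addr_ge0// !mulr_ge0// addr_ge0.
have hD y : `|discr (j ^ A) h a y| <= C1 * x ^+ (2 * B + 3).
  (* This lam is the first integral power of j above the square root of N j^3, which nearly balances
     the two chaining terms. At the last level A the remainder N j^-A is 1. *)
  have lam0 : 0 < x ^+ (2 * B + 2) by exact: exprn_gt0.
  apply: (le_trans (discr_sup hU A (j ^ A) h a y j0 lam0)).
  rewrite -/x natrX -exprMn divff ?gt_eqF// expr1n.
  have xge1 : 1 <= x ^+ (2 * B + 3) by exact: exprn_ege1.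
  have Hs (i : 'I_A.+1) : x * (x ^+ i * vari U (j ^ A) (x^-1 ^+ i) a
      / x ^+ (2 * B + 2) + x ^+ (2 * B + 2)) <= (C + 1) * x ^+ (2 * B + 3).
    have -> : x ^+ (2 * B + 3) = x * x ^+ (2 * B + 2) by rewrite -exprS addnS.
    rewrite mulrCA ler_pM2l// mulrDl mul1r lerD2r ler_pdivrMr//.
    have := hi i (ltn_ord i); rewrite -(ler_pM2l (exprn_gt0 i jr0)) => Hv.
    apply: (le_trans Hv); rewrite mulrCA -exprMn divff ?gt_eqF// expr1n mulr1.
    rewrite natrX -!mulrA ler_wpM2l// -!exprD; exact: ler_weXn2l.
  have := ler_sum (index_enum 'I_A.+1) (fun i _ => Hs i) (P := predT).
  rewrite sumr_const card_ord -[_ *+ _]mulr_natl /C1 => ?; lra.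
have vari0 : 0 <= vari U (j ^ A) h a by exact: vari_ge0.
apply: (le_trans (third_moment_le (ltW L0) hD)).
have C1x0 : 0 <= C1 * x ^+ (2 * B + 3) by rewrite mulr_ge0// exprn_ge0// ltW.
apply: (@le_trans _ _ ((3 * L + C1 * x ^+ (2 * B + 3)) * (C * x ^+ 3 * L))).
  by rewrite ler_wpM2l// addr_ge0// mulr_ge0// ltW.
have x4 : x ^+ 4 <= K * L by rewrite (le_trans _ hK)// ler_weXn2l// leq_addl.
have x8 : x ^+ (2 * B + 7) <= K ^+ 2 * L ^+ 2.
  rewrite -exprMn (le_trans (_ : _ <= (x ^+ (B + 4)) ^+ 2))//.
    by rewrite -exprM; exact: ler_weXn2l.
  by rewrite lerXn2r// nnegrE ?exprn_ge0// ltW// mulr_gt0.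
rewrite [leRHS]mulrAC ler_pdivlMr// -/C1.
have -> : (3 * L + C1 * x ^+ (2 * B + 3)) * (C * x ^+ 3 * L) * x =
    3 * C * L ^+ 2 * x ^+ 4 + C1 * C * L * x ^+ (2 * B + 7).
  have -> : x ^+ (2 * B + 7) = x ^+ (2 * B + 3) * x ^+ 4 by rewrite -exprD -addnA.
  by ring.
have -> : (3 * K * C + C1 * C * K ^+ 2) * L ^+ 3 =
    3 * C * L ^+ 2 * (K * L) + C1 * C * L * (K ^+ 2 * L ^+ 2) by ring.
by apply: lerD; rewrite ler_wpM2l// !mulr_ge0// ?exprn_ge0// ltW.
Qed.

Lemma grid_third_moment : 0 < K ->
  {ae U, forall a, exists C2, forall j l : nat, (0 < j)%N -> (0 < l <= 2 * j)%N ->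
    j%:R ^+ (B + 4) <= K * l%:R ^+ A ->
    `|mean U (fun y => (discr (j ^ A) ((l%:R / j%:R) ^+ A) a y + l%:R ^+ A) ^+ 3)
       - (l%:R ^+ A) ^+ 3| <= C2 / j%:R * (l%:R ^+ A) ^+ 3}.
Proof.
move=> K0.
(* The first list holds the chaining scales, the second the target lengths; the shifted base [j.+1]
   is positive. *)
pose H (j : nat) : seq R := [seq j.+1%:R^-1 ^+ i | i <- iota 0 A.+1] ++
  [seq (l%:R / j.+1%:R) ^+ A | l <- iota 1 (2 * j.+1)].
have N0 j : (0 < j.+1 ^ A)%N by rewrite expn_gt0.
have H0 j h : h \in H j -> 0 < h.
  rewrite mem_cat => /orP[] /mapP[i]; rewrite mem_iota => hi ->.
    by rewrite exprn_gt0// invr_gt0 ltr0n.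
  by rewrite exprn_gt0// divr_gt0// ltr0n; lia.
have sH j : (size (H j) <= (A + 3) * j.+1)%N.
  by rewrite size_cat !size_map !size_iota; lia.
have := ae_vari_le hU N0 H0 sH; apply: filterS => a [C hC].
pose C' := Num.max C 0.
exists (3 * K * C' + (2 * A.+1%:R * (C' + 1) + 2) * C' * K ^+ 2) => -[//|j] l _.
move=> /andP[l0 lj] hK.
have hC' h : h \in H j ->
    vari U (j.+1 ^ A) h a <= C' * (j.+1 ^ A)%:R * j.+1%:R ^+ 3 * h.
  move=> hH; apply: (le_trans (hC _ _ hH)); have h0 := ltW (H0 _ _ hH).
  by rewrite -!mulrA ler_wpM2r ?le_max ?lexx// !mulr_ge0 ?exprn_ge0.
apply: grid_third_moment_le => //.
- by rewrite le_max lexx orbT.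
- move=> i iA; apply: hC'; rewrite mem_cat; apply/orP; left.
  by apply/mapP; exists i => //; rewrite mem_iota.
- apply: hC'; rewrite mem_cat; apply/orP; right.
  by apply/mapP; exists l => //; rewrite mem_iota; lia.
Qed.

End ThirdMoment.

(** * Comparison of W with half-open counts *)

Lemma ler_sum_widen (R : realDomainType) (F : nat -> R) (m n : nat) :
  (m <= n)%N -> (forall i, 0 <= F i) -> \sum_(i < m) F i <= \sum_(i < n) F i.
Proof.
move=> mn F0; rewrite -!(big_mkord xpredT F) (big_cat_nat (leq0n m) mn)//= lerDl.
exact: sumr_ge0.
Qed.

Section Counting.
Context (R : realType).
Implicit Types (a b h y x L : R).

Lemma discrD N h a y : discr N h a y + N%:R * h =
  \sum_(i < N) ((Num.ceil (y - a * i.+1%:R ^+ 2 + h))%:~R -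
                (Num.ceil (y - a * i.+1%:R ^+ 2))%:~R).
Proof.
rewrite discrE -[N in N%:R]card_ord mulr_natl -sumr_const -big_split/=.
by apply: eq_bigr => i _; rewrite sawincE subrK.
Qed.

Lemma ceil_incr_ge0 x h : 0 <= h ->
  0 <= (Num.ceil (x + h))%:~R - (Num.ceil x)%:~R :> R.
Proof. by move=> h0; rewrite subr_ge0 ler_int le_ceil// lerDl. Qed.

(** [y, y + h') lies in the closed interval and, as h' <= 1, contains at most one integer translate
    of [b]. *)
Lemma ceil_incr_le_hit b y h h' : h' <= h -> h' <= 1 ->
  (Num.ceil (y - b + h'))%:~R - (Num.ceil (y - b))%:~R
    <= (`[< in_itv_mod1 b y (y + h) >])%:R :> R.
Proof.
move=> hh h1; set u := Num.ceil (_ + _); set v := Num.ceil _.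
have [uv|vu] := leP u v.
  by rewrite (@le_trans _ _ 0)// subr_le0 ler_int.
have -> : `[< in_itv_mod1 b y (y + h) >].
  (* [v] is the least integer at or above y - b; since v < u it lies below y - b + h'. *)
  apply/asboolP; exists v; have := ceil_ge (y - b); rewrite -/v => ?.
  by move: vu; rewrite /u ceil_gt_int => ?; lra.
have : u <= v + 1.
  have -> : v + 1 = Num.ceil (y - b + 1) by rewrite ceilDrz// ceil1.
  by rewrite le_ceil// lerD2l.
by rewrite -(ler_int R) intrD lerBlDr addrC.
Qed.

(** The strict h < h' puts the right endpoint of the closed interval inside the half-open one.
    Multiple hits only enlarge the count, so h' may exceed 1. *)
Lemma hit_le_ceil_incr b y h h' : h < h' -> 0 <= h' ->
  (`[< in_itv_mod1 b y (y + h) >])%:R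
    <= (Num.ceil (y - b + h'))%:~R - (Num.ceil (y - b))%:~R :> R.
Proof.
move=> hh h0; case: asboolP => [[k /andP[k1 k2]]|_]; last exact: ceil_incr_ge0.
have kv : Num.ceil (y - b) <= k by rewrite ceil_le_int; lra.
have ku : k + 1 <= Num.ceil (y - b + h') by rewrite lezD1 ceil_gt_int; lra.
have : Num.ceil (y - b) + 1 <= Num.ceil (y - b + h') by lia.
by rewrite -(ler_int R) intrD lerBrDr addrC.
Qed.

Lemma WcountE a L N y : (Wcount a L N y)%:R =
  \sum_(i < N) (`[< in_itv_mod1 (a * i.+1%:R ^+ 2) y (y + L / N%:R) >])%:R :> R.
Proof.
rewrite /Wcount cardsE -sum1_card natr_sum big_mkcond/=.
by apply: eq_bigr => i _; rewrite unfold_in /=; case: ifP.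
Qed.

Lemma Wcount_ge a L M N h y : (M <= N)%N -> h <= L / N%:R -> h <= 1 ->
  discr M h a y + M%:R * h <= (Wcount a L N y)%:R.
Proof.
move=> MN hL h1; rewrite discrD WcountE.
apply: (@le_trans _ _ (\sum_(i < M)
    (`[< in_itv_mod1 (a * i.+1%:R ^+ 2) y (y + L / N%:R) >])%:R)).
  by apply: ler_sum => i _; exact: ceil_incr_le_hit.
exact: (ler_sum_widen (F := fun i =>
    (`[< in_itv_mod1 (a * i.+1%:R ^+ 2) y (y + L / N%:R) >])%:R)).
Qed.

Lemma Wcount_le a L M N h y : (N <= M)%N -> L / N%:R < h -> 0 <= h ->
  (Wcount a L N y)%:R <= discr M h a y + M%:R * h.
Proof.
move=> NM hL h0; rewrite discrD WcountE.
apply: (@le_trans _ _ (\sum_(i < N)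
    ((Num.ceil (y - a * i.+1%:R ^+ 2 + h))%:~R -
     (Num.ceil (y - a * i.+1%:R ^+ 2))%:~R))).
  by apply: ler_sum => i _; exact: hit_le_ceil_incr.
apply: (ler_sum_widen (F := fun i =>
    ((Num.ceil (y - a * i.+1%:R ^+ 2 + h))%:~R -
     (Num.ceil (y - a * i.+1%:R ^+ 2))%:~R))) => // i.
exact: ceil_incr_ge0.
Qed.

(** For each n the hitting set in y is the countable union over integers k of the intervals
    [b + k - h, b + k]. *)
Lemma bmfun_Wcount a L N : bmfun (fun y => (Wcount a L N y)%:R : R).
Proof.
rewrite [X in bmfun X](_ : _ = fun y => \sum_(i < N)
    (`[< in_itv_mod1 (a * i.+1%:R ^+ 2) y (y + L / N%:R) >])%:R); last first.
  by apply/funext => y; rewrite WcountE.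
apply: bmfun_sum => i; split; last first.
  by exists 1 => y; case: asbool; rewrite ?normr0 ?normr1.
set b := a * _; set h := L / _.
pose hits := \bigcup_(k in [set: int]) `[b + k%:~R - h, b + k%:~R]%classic.
have mA : measurable hits.
  apply: countable_bigcupT_measurable => [|k]; first exact: countableP.
  exact: measurable_itv.
rewrite [X in measurable_fun _ X](_ : _ = \1_hits).
  exact: measurable_indic.
apply/funext => y; rewrite indicE; congr (_%:R); congr nat_of_bool.
apply/asboolP/idP => [[k /andP[k1 k2]]|].
  by apply/mem_set; exists k => //=; rewrite in_itv/=; lra.
by move=> /set_mem [k _] /=; rewrite in_itv/= => /andP[? ?]; exists k; lra.
Qed.

End Counting.

(** * Sandwiching *)

Lemma bernoulli_ge (R : realDomainType) (x : R) n : 0 <= x <= 1 ->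
  1 - n%:R * x <= (1 - x) ^+ n.
Proof.
move=> /andP[x0 x1]; elim: n => [|n IH]; first by rewrite mul0r subr0.
have n0 : 0 <= n%:R :> R by [].
have : 0 <= ((1 - x) ^+ n - (1 - n%:R * x)) * (1 - x).
  by rewrite mulr_ge0// subr_ge0.
have : 0 <= n%:R * (x * x) by rewrite !mulr_ge0.
by rewrite exprS -natr1; move: ((1 - x) ^+ n) (n%:R) => p k; lra.
Qed.

(** Bernoulli gives (r/(r+1))^A >= 1 - A/(r+1), which is at least 1 - A/r0 uniformly in r >= r0. *)
Lemma ratio_exp_ge (R : realFieldType) (A r0 r : nat) : (0 < r0 <= r)%N ->
  (1 - A%:R / r0%:R) * r.+1%:R ^+ A <= r%:R ^+ A :> R.
Proof.
move=> /andP[r00 r0r]; have r1 : 0 < r.+1%:R :> R by rewrite ltr0n.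
have -> : r%:R = (1 - r.+1%:R^-1) * r.+1%:R :> R.
  by rewrite mulrBl mulVf ?gt_eqF// -natr1; lra.
rewrite exprMn ler_pM2r ?exprn_gt0//.
have r1i : 0 <= (r.+1%:R^-1 : R) <= 1.
  by apply/andP; split; [rewrite invr_ge0 ltW|rewrite invf_le1 ?ler1n].
apply: le_trans (bernoulli_ge A r1i).
rewrite lerD2l lerN2 ler_wpM2l// lef_pV2 ?posrE ?ltr0n// ler_nat; lia.
Qed.

Lemma root_index (R : archiRealFieldType) (A : nat) (X : R) : (0 < A)%N -> 0 <= X ->
  exists l : nat, l%:R ^+ A <= X < l.+1%:R ^+ A.
Proof.
move=> A0 X0; pose P l := (l ^ A <= Num.truncn X)%N.
have P0 : exists l, P l by exists 0%N; rewrite /P exp0n.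
have Pb l : P l -> (l <= Num.truncn X)%N.
  move=> Pl; apply: leq_trans Pl; case: l => // l.
  by rewrite -{1}[l.+1]expn1 leq_pexp2l.
have /andP[X1 X2] := truncn_itv X0.
case: (ex_maxnP P0 Pb) => l Pl lmax; exists l; apply/andP; split.
  by apply: le_trans X1; rewrite -natrX ler_nat.
apply: (lt_le_trans X2); rewrite -natrX ler_nat ltnNge.
by apply/negP => /lmax; rewrite ltnn.
Qed.

Section Sandwich.
Context (R : realType) (U : probability R R) (a : R) (B : nat).
Let A := (4 * B)%N.
Variables (C2 : R).
Hypotheses (B0 : (0 < B)%N)
  (grid : forall j l : nat, (0 < j)%N -> (0 < l <= 2 * j)%N ->
    j%:R ^+ (B + 4) <= 2 ^+ (B + 4) * l%:R ^+ A :> R ->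
    `|mean U (fun y => (discr (j ^ A) ((l%:R / j%:R) ^+ A) a y + l%:R ^+ A) ^+ 3)
       - (l%:R ^+ A) ^+ 3| <= C2 / j%:R * (l%:R ^+ A) ^+ 3).

Definition moment3 (N : nat) (L : R) : R :=
  mean U (fun y => (Wcount a L N y)%:R ^+ 3).

(** [theta] bounds from below the ratio of consecutive A-th powers from r0 on; [eta] bounds the
    relative error of the grid moments. *)
Variables (r0 : nat) (theta eta : R).
Hypotheses (r00 : (0 < r0)%N) (thetaE : theta = 1 - A%:R / r0%:R)
  (theta2 : 2^-1 <= theta).

Variables (j N : nat) (L : R).
Hypotheses (r0j : (r0 <= j)%N) (r0Aj : (2 * r0 ^ A <= j)%N)
  (C2j : C2 <= eta * j%:R) (eta0 : 0 <= eta) (eta1 : eta <= 1)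
  (jN : (j ^ A <= N < j.+1 ^ A)%N)
  (jL : j%:R ^+ (B + 4) < L) (LN : L <= N%:R).

Let A0 : (0 < A)%N. Proof. by rewrite muln_gt0. Qed.
Let j0 : (0 < j)%N. Proof. exact: leq_trans r0j. Qed.
Let theta_gt0 : 0 < theta. Proof. by apply: lt_le_trans theta2; rewrite invr_gt0. Qed.

Let jltL : j%:R < L.
Proof.
apply: le_lt_trans jL.
by rewrite -[leLHS]expr1 ler_weXn2l ?ler1n ?addn4.
Qed.
Let L0 : 0 < L. Proof. exact: le_lt_trans jltL. Qed.

Let N0 : 0 < N%:R :> R. Proof. exact: lt_le_trans LN. Qed.

Let jAN : j%:R ^+ A <= N%:R :> R.
Proof. by rewrite -natrX ler_nat; case/andP: jN. Qed.

Let NjA : N%:R < j.+1%:R ^+ A :> R.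
Proof. by rewrite -natrX ltr_nat; case/andP: jN. Qed.

Let theta_jA : theta * j.+1%:R ^+ A <= j%:R ^+ A.
Proof. by rewrite thetaE ratio_exp_ge// r00. Qed.

(** Brings l into the range of the ratio bound; this is where 2 r0^A <= j enters. *)
Let large_index (l : nat) : j%:R / 2 < l.+1%:R ^+ A :> R -> (r0 <= l)%N.
Proof.
move=> jl; have : (r0 ^ A)%:R < l.+1%:R ^+ A :> R.
  apply: le_lt_trans jl; rewrite ler_pdivlMr// mulrC.
  by rewrite -(natrM _ 2) ler_nat.
by rewrite -natrX ltr_nat ltn_exp2r.
Qed.

Let volE (i l : nat) : (0 < i)%N ->
  (i ^ A)%:R * (l%:R / i%:R) ^+ A = l%:R ^+ A :> R.
Proof.
by move=> i0; rewrite natrX -exprMn mulrC divfK// pnatr_eq0 -lt0n.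
Qed.

Let bmfun_cnt i h s :
  bmfun (fun y => (discr (R := R) i h a y + s) ^+ 3).
Proof.
by apply: bmfunX; apply: bmfunD; [exact: bmfun_discr|exact: bmfun_cst].
Qed.

(** N is rounded down to j^A and L j^A / N down to l^A, so the grid count lies below W. Each
    rounding costs one factor [theta], so l^A >= theta^2 L, and cubing gives theta^6. *)
Lemma moment3_ge : theta ^+ 6 * (1 - eta) * L ^+ 3 <= moment3 N L.
Proof.
have [l /andP[lX Xl]] := root_index A0 (X := L * j%:R ^+ A / N%:R)
  (divr_ge0 (mulr_ge0 (ltW L0) (exprn_ge0 _ (ler0n _ _))) (ltW N0)).
have XL : L * j%:R ^+ A / N%:R <= L by rewrite ler_pdivrMr// ler_pM2l.
have LX : theta * L <= L * j%:R ^+ A / N%:R.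
  rewrite ler_pdivlMr// mulrAC mulrC ler_pM2l// (le_trans _ theta_jA)//.
  by rewrite ler_pM2l// ltW.
have r0l : (r0 <= l)%N.
  apply: large_index; apply: le_lt_trans Xl; apply: le_trans LX.
  by move: jltL theta2 L0; move: (j%:R : R) => x; nra.
have l0 : (0 < l)%N by exact: leq_trans r0l.
have lL : theta ^+ 2 * L <= l%:R ^+ A.
  apply: le_trans (_ : theta * l.+1%:R ^+ A <= _); last first.
    by rewrite thetaE ratio_exp_ge// r00.
  by rewrite expr2 -mulrA ler_pM2l// (le_trans LX)// ltW.
have lj : (l <= j)%N.
  rewrite -(@leq_exp2r _ _ A)// -(ler_nat R) !natrX (le_trans lX)//.
  by rewrite ler_pdivrMr// mulrC ler_wpM2l// exprn_ge0.
have hK : j%:R ^+ (B + 4) <= 2 ^+ (B + 4) * l%:R ^+ A :> R.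
  (* theta >= 1/2 gives L <= 4 theta^2 L, and 4 <= 2^(B+4). *)
  apply: (le_trans (ltW jL)); apply: (@le_trans _ _ (4 * l%:R ^+ A)).
    apply: (@le_trans _ _ (4 * (theta ^+ 2 * L))); last by rewrite ler_wpM2l.
    rewrite mulrA ler_peMl ?(ltW L0)//.
    by move: theta2; rewrite expr2; move: theta => t; nra.
  rewrite ler_wpM2r ?exprn_ge0// (_ : 4 = 2 ^+ 2 :> R); last by rewrite expr2; lra.
  by rewrite ler_weXn2l ?ler1n ?addn4.
have l2j : (0 < l <= 2 * j)%N by rewrite l0 (leq_trans lj) ?leq_pmull.
have jr0 : 0 < j%:R :> R by rewrite ltr0n.
have Cj : C2 / j%:R <= eta by rewrite ler_pdivrMr.
have V0 : 0 < l%:R ^+ A :> R by rewrite exprn_gt0// ltr0n.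
apply: (@le_trans _ _ ((1 - eta) * (l%:R ^+ A) ^+ 3)).
  rewrite mulrAC mulrC ler_wpM2l ?subr_ge0// (exprM theta 2 3) -exprMn.
  by rewrite lerXn2r ?nnegrE// ?mulr_ge0 ?exprn_ge0// ltW.
apply: (@le_trans _ _ (mean U (fun y =>
    (discr (j ^ A) ((l%:R / j%:R) ^+ A) a y + l%:R ^+ A) ^+ 3))).
  have := grid j0 l2j hK; rewrite ler_norml => /andP[+ _].
  have : C2 / j%:R * (l%:R ^+ A) ^+ 3 <= eta * (l%:R ^+ A) ^+ 3.
    by rewrite ler_wpM2r// exprn_ge0// ltW.
  by lra.
apply: le_mean => // [|y]; first exact: bmfunX (bmfun_Wcount _ _ _).
have h0 : 0 <= (l%:R / j%:R) ^+ A :> R by rewrite exprn_ge0// divr_ge0.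
rewrite -(volE l j0) lerXn2r ?nnegrE//.
  by have := discr_ge (j ^ A) a y h0; rewrite -subr_ge0 opprK.
apply: Wcount_ge; first by case/andP: jN.
  by rewrite expr_div_n ler_pdivlMr// mulrAC ler_pdivrMr ?exprn_gt0// -ler_pdivlMr.
by rewrite exprn_ile1// ?divr_ge0// ler_pdivrMr// mul1r ler_nat.
Qed.

(** Here N is rounded up to (j+1)^A and L (j+1)^A / N strictly up to (l+1)^A; strictness is what
    covers the closed interval. The index l + 1 can reach j + 2, hence the range l <= 2 j on the
    grid. *)
Lemma moment3_le : theta ^+ 6 * moment3 N L <= (1 + eta) * L ^+ 3.
Proof.
have [l /andP[lX Xl]] := root_index A0 (X := L * j.+1%:R ^+ A / N%:R)
  (divr_ge0 (mulr_ge0 (ltW L0) (exprn_ge0 _ (ler0n _ _))) (ltW N0)).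
have LX : L <= L * j.+1%:R ^+ A / N%:R by rewrite ler_pdivlMr// ler_pM2l// ltW.
have XL : theta * (L * j.+1%:R ^+ A / N%:R) <= L.
  rewrite mulrA ler_pdivrMr// mulrCA ler_pM2l// (le_trans theta_jA)//.
have r0l : (r0 <= l)%N.
  apply: large_index; apply: le_lt_trans Xl; apply: le_trans LX.
  by move: jltL (ler0n R j); move: (j%:R : R) => x; lra.
have lL : theta ^+ 2 * l.+1%:R ^+ A <= L.
  apply: le_trans XL; rewrite expr2 -mulrA ler_pM2l// (le_trans _ lX)//.
  by rewrite thetaE ratio_exp_ge// r00.
have lj : (l <= j.+1)%N.
  rewrite -(@leq_exp2r _ _ A)// -(ler_nat R) !natrX (le_trans lX)//.
  by rewrite ler_pdivrMr// mulrC ler_wpM2l// exprn_ge0.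
have hK : j.+1%:R ^+ (B + 4) <= 2 ^+ (B + 4) * l.+1%:R ^+ A :> R.
  (* The constant 2^(B+4) absorbs the passage from j to j + 1 <= 2 j. *)
  apply: (@le_trans _ _ (2 ^+ (B + 4) * j%:R ^+ (B + 4))).
    rewrite -exprMn lerXn2r// ?nnegrE ?mulr_ge0//.
    by rewrite -(natrM _ 2) ler_nat mul2n -addnn -addn1 leq_add2l.
  rewrite ler_pM2l ?exprn_gt0// (le_trans (ltW jL))// (le_trans LX)// ltW//.
have l2j : (0 < l.+1 <= 2 * j.+1)%N.
  by rewrite /= (leq_ltn_trans lj)// mul2n -addnn addSn ltnS leq_addl.
have Cj : C2 / j.+1%:R <= eta.
  by rewrite ler_pdivrMr ?ltr0n// (le_trans C2j)// ler_wpM2l// ler_nat.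
have V0 : 0 < l.+1%:R ^+ A :> R by rewrite exprn_gt0// ltr0n.
apply: (@le_trans _ _ (theta ^+ 6 * ((1 + eta) * (l.+1%:R ^+ A) ^+ 3))); last first.
  rewrite mulrCA ler_pM2l ?ltr_pwDl// (exprM theta 2 3) -exprMn.
  by rewrite lerXn2r ?nnegrE// ?mulr_ge0 ?exprn_ge0// ltW.
rewrite ler_pM2l ?exprn_gt0//.
apply: (@le_trans _ _ (mean U (fun y =>
    (discr (j.+1 ^ A) ((l.+1%:R / j.+1%:R) ^+ A) a y + l.+1%:R ^+ A) ^+ 3))).
  have h0 : 0 <= (l.+1%:R / j.+1%:R) ^+ A :> R by rewrite exprn_ge0// divr_ge0.
  apply: le_mean => // [|y]; first exact: bmfunX (bmfun_Wcount _ _ _).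
  rewrite -(volE l.+1 (ltn0Sn j)) lerXn2r ?nnegrE//.
    by have := discr_ge (j.+1 ^ A) a y h0; rewrite -subr_ge0 opprK.
  apply: Wcount_le => //; first by case/andP: jN => _ /ltnW.
  rewrite expr_div_n ltr_pdivlMr ?exprn_gt0 ?ltr0n// mulrAC.
  exact: Xl.
have := grid (ltn0Sn j) l2j hK; rewrite ler_norml => /andP[_].
rewrite lerBlDr => /le_trans; apply; rewrite mulrDl mul1r addrC lerD2l.
by rewrite ler_wpM2r// exprn_ge0// ltW.
Qed.

End Sandwich.

(** * Choice of parameters and return to the expectation over Y *)

Lemma expectation_Wcount3 (R : realType) (d : measure_display)
    (Omega : measurableType d) (P : probability Omega R) (Y : {RV P >-> R})
    (a L : R) (N : nat) :
  ('E_P[fun w => ((Wcount a L N (Y w))%:R ^+ 3)%R] =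
    (moment3 (distribution P Y) a N L)%:E)%E.
Proof.
have hW : bmfun (fun y : R => (Wcount a L N y)%:R ^+ 3 : R).
  exact: bmfunX (bmfun_Wcount a L N).
rewrite unlock EFin_mean// ge0_integral_distribution//.
by apply/measurable_EFinP; case: hW.
Qed.

(** N >= j^(4B) gives N^(1/4+eps) >= j^(B + 4 B eps), and 4 B eps >= 4. *)
Lemma exp_lt_of_powR_lt (R : realType) (eps L : R) (B j N : nat) :
  0 < eps -> 1 <= B%:R * eps -> (0 < j)%N -> (j ^ (4 * B) <= N)%N ->
  N%:R `^ (4^-1 + eps) < L -> j%:R ^+ (B + 4) < L.
Proof.
move=> e0 Be j0 jN; apply: le_lt_trans.
have p0 : 0 <= 4^-1 + eps by rewrite addr_ge0 ?invr_ge0// ltW.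
apply: (@le_trans _ _ ((j ^ (4 * B))%:R `^ (4^-1 + eps))); last first.
  by apply: ge0_ler_powR; rewrite ?nnegrE// ler_nat.
rewrite natrX -!powR_mulrn// -powRrM ler_powR ?ler1n//.
by rewrite natrM natrD; lra.
Qed.

Lemma grid_index (A N j0 : nat) : (0 < A)%N -> (j0 ^ A <= N)%N ->
  exists2 j, (j0 <= j)%N & (j ^ A <= N < j.+1 ^ A)%N.
Proof.
move=> A0 jN; pose P j := (j ^ A <= N)%N.
have Pb j : P j -> (j <= N)%N.
  move=> Pj; apply: leq_trans Pj; case: j => // j.
  by rewrite -{1}[j.+1]expn1 leq_pexp2l.
case: (ex_maxnP (ex_intro P j0 jN) Pb) => j Pj jmax.
exists j; first exact: jmax.
apply/andP; split=> //; rewrite ltnNge.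
by apply/negP => /jmax; rewrite ltnn.
Qed.

Lemma moment3_asymptotic (R : realType) (U : probability R R) (a eps : R)
    (B : nat) (C2 delta : R) : (0 < B)%N -> 0 < eps -> 1 <= B%:R * eps ->
  (forall j l : nat, (0 < j)%N -> (0 < l <= 2 * j)%N ->
    j%:R ^+ (B + 4) <= 2 ^+ (B + 4) * l%:R ^+ (4 * B) :> R ->
    `|mean U (fun y => (discr (j ^ (4 * B)) ((l%:R / j%:R) ^+ (4 * B)) a y
         + l%:R ^+ (4 * B)) ^+ 3) - (l%:R ^+ (4 * B)) ^+ 3|
       <= C2 / j%:R * (l%:R ^+ (4 * B)) ^+ 3) ->
  0 < delta ->
  exists N0 : nat, forall N : nat, (N0 <= N)%N ->
    forall L : R, N%:R `^ (4^-1 + eps) < L -> L <= N%:R ->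
    `|moment3 U a N L - L ^+ 3| <= delta * L ^+ 3.
Proof.
move=> B0 e0 Be grid delta0.
(* With eta = D/2 and theta^6 >= 1 - D/4, the end needs (1 - D/4)(1 - D/2) >= 1 - D and (1 - D/4)(1
   + D) >= 1 + D/2; the latter uses D <= 1. *)
pose D := Num.min delta 1.
have D0 : 0 < D by rewrite lt_min delta0 ltr01.
have D1 : D <= 1 by rewrite ge_min lexx orbT.
have Dd : D <= delta by rewrite ge_min lexx.
pose A := (4 * B)%N; have A0 : (0 < A)%N by rewrite muln_gt0.
(* This makes 1 - theta <= D/24, so the sixth power loses at most D/4 by Bernoulli. *)
pose r0 := (Num.truncn (24 * A%:R / D)).+1.
have r0gt : A%:R / r0%:R <= D / 24.
  have : 24 * A%:R / D <= r0%:R by exact/ltW/truncnS_gt.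
  by rewrite ler_pdivrMr// ler_pdivrMr ?ltr0n// => ?; lra.
pose theta : R := 1 - A%:R / r0%:R.
have theta1 : theta <= 1 by rewrite gerBl divr_ge0.
have thetage : 1 - D / 24 <= theta by rewrite lerD2l lerN2.
have theta2 : 2^-1 <= theta by lra.
have theta6 : 1 - D / 4 <= theta ^+ 6.
  have x01 : 0 <= 1 - theta <= 1 by apply/andP; split; lra.
  by have := bernoulli_ge 6 x01; rewrite subKr; apply: le_trans; lra.
(* The three thresholds serve the ratio bound at j, the ratio bound at l, and C2/j <= D/2. *)
pose j0 := maxn r0 (maxn (2 * r0 ^ A) (Num.truncn (C2 / (D / 2))).+1).
exists (j0 ^ A)%N => N NN0 L NL LN.
have [j j0j jN] := grid_index A0 NN0.
have := j0j; rewrite !geq_max => /and3P[r0j rAj Cj].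
have jgt0 : (0 < j)%N by exact: leq_trans r0j.
have jL : j%:R ^+ (B + 4) < L.
  apply: exp_lt_of_powR_lt e0 Be jgt0 _ NL; by case/andP: jN.
have C2j : C2 <= D / 2 * j%:R.
  rewrite mulrC -ler_pdivrMr; last by lra.
  apply: le_trans (ltW (truncnS_gt _)) _; by rewrite ler_nat.
have eta0 : 0 <= D / 2 by lra.
have eta1 : D / 2 <= 1 by lra.
have L0 : 0 < L by apply: le_lt_trans jL; exact: exprn_ge0.
have L3 : 0 < L ^+ 3 by exact: exprn_gt0.
have lo := moment3_ge B0 grid (ltn0Sn _) erefl theta2 r0j rAj C2j eta1 jN jL LN.
have up := moment3_le B0 grid (ltn0Sn _) erefl theta2 r0j rAj C2j eta0 jN jL LN.
rewrite -/theta in lo up.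
have theta60 : 0 < theta ^+ 6 by apply: lt_le_trans theta6; lra.
apply: (@le_trans _ _ (D * L ^+ 3)); last by rewrite ler_pM2r.
rewrite ler_norml; apply/andP; split.
  rewrite lerBrDr (le_trans _ lo)//.
  rewrite (_ : - (D * L ^+ 3) + L ^+ 3 = (1 - D) * L ^+ 3); last by lra.
  rewrite ler_pM2r//; move: theta6; move: (theta ^+ 6) => t; nra.
rewrite lerBlDr -(ler_pM2l theta60) (le_trans up)//.
rewrite (_ : D * L ^+ 3 + L ^+ 3 = (1 + D) * L ^+ 3); last by lra.
rewrite [leRHS]mulrA ler_pM2r//; move: theta6; move: (theta ^+ 6) => t; nra.
Qed.

Theorem mainTheorem1 (R : realType) (d : measure_display)
    (Omega : measurableType d) (P : probability Omega R) (Y : {RV P >-> R})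
    (hY : uniform01 Y) (eps : R) (heps : 0 < eps) :
  {ae (@lebesgue_measure R), forall alpha : R, 0 <= alpha <= 1 ->
    forall delta : R, 0 < delta ->
    exists N0 : nat, forall N : nat, (N0 <= N)%N ->
    forall L : R, N%:R `^ (4^-1 + eps) < L -> L <= N%:R ->
      (`| 'E_P[fun w => ((Wcount alpha L N (Y w))%:R ^+ 3)%R] - (L ^+ 3)%R%:E |
         <= (delta * L ^+ 3)%R%:E)%E }.
Proof.
(* B depends on eps alone, so the null set of alpha is fixed before delta, N and L. *)
pose B := (Num.truncn eps^-1).+1.
have Be : 1 <= B%:R * eps.
  by rewrite -ler_pdivrMr// mul1r; exact/ltW/truncnS_gt.
have hU : uniform_law (distribution P Y) by exact: hY.
have K0 : 0 < 2 ^+ (B + 4) :> R by rewrite exprn_gt0.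
(* The law of Y also stands in for the law of alpha; its null sets transfer to Lebesgue measure on
   [0, 1]. *)
apply: (uniform_law_ae hU); have := grid_third_moment hU B K0.
apply: filterS => a [C2 grid] delta delta0.
have [N0 hN0] := moment3_asymptotic (ltn0Sn _) heps Be grid delta0.
exists N0 => N NN0 L NL LN.
by rewrite expectation_Wcount3 -EFinB abse_EFin lee_fin; exact: hN0.
Qed.
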